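(* Let $(R,\mathfrak m,k)$ be a commutative noetherian local ring and let $a,b\in\mathfrak m\smallsetminus\mathfrak m^2$ form an exact pair of zero divisors. Then for every finitely generated $R/aR$-module $M$, $$P^R_M(t)=P^{R/aR}_M(t)\cdot\frac{1}{1-t}.$$
   Context: Elements $a,b$ of a commutative ring $R$ form an exact pair of zero divisors if $a,b$ are nonzero non-units with $(0:_R a)=bR$ and $(0:_R b)=aR$. For a local ring $(S,\mathfrak n,k)$ and a finitely generated $S$-module $M$, the Poincaré series is $P^S_M(t)=\sum_{n\ge0}\operatorname{rank}_k\operatorname{Tor}^S_n(M,k)\,t^n$. *)

(* Defs.v *)
From HB Require Import structures.
From mathcomp Require Import all_boot all_order all_algebra.
Set Implicit Arguments. Unset Strict Implicit. Unset Printing Implicit Defensive.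
Import GRing.Theory.
Local Open Scope ring_scope.

Section RingDefs.
Variable R : comUnitRingType.

Definition is_ideal (I : R -> Prop) : Prop :=
  I 0 /\ (forall x y, I x -> I y -> I (x + y)) /\ (forall r x, I x -> I (r * x)).

Definition ideal_fg (I : R -> Prop) : Prop :=
  exists s : seq R, (forall x, x \in s -> I x) /\
    forall x, I x -> exists c : seq R, size c = size s /\
      x = \sum_(i < size s) c`_i * s`_i.

Definition noetherian : Prop := forall I, is_ideal I -> ideal_fg I.

(* (R, m, k) local with residue field k: pi : R -> k is surjective and its
   kernel m is exactly the set of non-units (so m is the unique maximal ideal). *)
Definition residue_map (k : fieldType) (pi : {rmorphism R -> k}) : Prop :=
  (forall y : k, exists x, pi x = y) /\ (forall x, pi x = 0 <-> x \notin GRing.unit).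

Definition in_msq (k : fieldType) (pi : {rmorphism R -> k}) (x : R) : Prop :=
  exists s t : seq R, size s = size t /\ (forall y, y \in s -> pi y = 0) /\
     (forall y, y \in t -> pi y = 0) /\ x = \sum_(i < size s) s`_i * t`_i.

Definition exact_pair (a b : R) : Prop :=
  a != 0 /\ b != 0 /\ a \notin GRing.unit /\ b \notin GRing.unit /\
  (forall x, x * a = 0 <-> exists r, x = b * r) /\
  (forall x, x * b = 0 <-> exists r, x = a * r).

Definition is_quotient_by (S : comUnitRingType) (q : {rmorphism R -> S}) (a : R) : Prop :=
  (forall y : S, exists x, q x = y) /\ (forall x, q x = 0 <-> exists r, x = a * r).

End RingDefs.

Definition module_fg (S : comUnitRingType) (M : lmodType S) : Prop :=
  exists s : seq M, forall m : M, exists c : seq S, size c = size s /\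
    m = \sum_(i < size s) c`_i *: s`_i.

(* A free resolution of M over T, where T acts on M through phi : T -> S:
     ... -> T^(b 2) --d 1--> T^(b 1) --d 0--> T^(b 0) --eps--> M -> 0
   (row-vector convention: d n : T^(b n.+1) -> T^(b n), v |-> v *m d n). *)
Definition is_free_resolution (T S : comUnitRingType) (phi : T -> S) (M : lmodType S)
  (b : nat -> nat) (d : forall n, 'M[T]_(b n.+1, b n)) (eps : 'rV[T]_(b 0%N) -> M) : Prop :=
  (forall u v, eps (u + v) = eps u + eps v) /\
  (forall r v, eps (r *: v) = phi r *: eps v) /\
  (forall m, exists v, eps v = m) /\
  (forall v, eps v = 0 <-> exists w, v = w *m d 0) /\
  (forall n (v : 'rV[T]_(b n.+1)), v *m d n = 0 <-> exists w, v = w *m d n.+1).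

(* rank_k Tor^T_n(M, k) computed as the dimension of H_n(F (x)_T k) for the
   free resolution F = (b, d):
   dim ker(dbar_(n-1)) - dim im(dbar_n) = b n - rank dbar_(n-1) - rank dbar_n. *)
Definition tor_dim (T : comUnitRingType) (k : fieldType) (pi : {rmorphism T -> k})
  (b : nat -> nat) (d : forall n, 'M[T]_(b n.+1, b n)) (n : nat) : nat :=
  (b n - \rank (map_mx pi (d n)) -
     (if n is n'.+1 then \rank (map_mx pi (d n')) else 0))%N.

Arguments is_free_resolution {T S} phi {M} b d eps.
Arguments tor_dim {T k} pi b d n.

(* Main.v *)
(** Compute with a minimal free resolution of M over S = R/a and let N be the
    first syzygy, a submodule of n S^m, where n is the maximal ideal of S. A
    minimal free resolution P of N over R maps to the resolution
      ... -a-> R^m -b-> R^m -a-> R^m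
    of S^m, by a chain map f lifting the inclusion. All f_i vanish modulo the
    maximal ideal m_R of R: f_0 does because N lies in n S^m, and if f_i does
    then x f_(i+1) = d f_i, with x one of a, b, has entries in m_R^2, so an
    entry of f_(i+1) outside m_R would put x in m_R^2. Hence the cone of f is a
    minimal resolution of M over R, which gives
    beta^R_(i+1)(M) = beta^S_0(M) + beta^R_i(N), and one concludes by induction
    on i. *)

Require Import Defs.
From HB Require Import structures.
From mathcomp Require Import all_boot all_order all_algebra.
From Stdlib Require Import ClassicalEpsilon.
Set Implicit Arguments. Unset Strict Implicit. Unset Printing Implicit Defensive.
Import GRing.Theory.
Local Open Scope ring_scope.

(** * Dependent choice and lifting of matrices row by row *)

(** Choosing inside the subtype cut out by [P n] turns the step into a function, so that plain
    recursion on [n] builds the sequence. *)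
Lemma dependent_choice (A : nat -> Type) (P : forall n, A n -> Prop)
    (Q : forall n, A n -> A n.+1 -> Prop) (x0 : A 0%N) :
  P 0%N x0 ->
  (forall n x, P n x -> exists y, P n.+1 y /\ Q n x y) ->
  exists f : forall n, A n, f 0%N = x0 /\ forall n, P n (f n) /\ Q n (f n) (f n.+1).
Proof.
move=> P0 step.
have next n (x : {x | P n x}) :
    {y : {y | P n.+1 y} | Q n (sval x) (sval y)}.
  apply: constructive_indefinite_description.
  by case: x => x Px; have [y [Py Qxy]] := step n x Px; exists (exist _ y Py).
pose f := fix f n : {x | P n x} :=
  if n is m.+1 then sval (next m (f m)) else exist _ x0 P0.
exists (fun n => sval (f n)); split=> // n.
by split; [exact: (svalP (f n)) | exact: (svalP (next n (f n)))].
Qed.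

Section MatrixLift.
Variable T : comUnitRingType.

Lemma rows_lift m n p (X : 'M[T]_(m, n)) (D : 'M[T]_(p, n)) :
  (forall v : 'rV_m, exists w, v *m X = w *m D) -> exists Y, X = Y *m D.
Proof.
move=> H.
pose y i := proj1_sig (constructive_indefinite_description _ (H (delta_mx 0 i))).
have yE i : delta_mx 0 i *m X = y i *m D.
  exact: (proj2_sig (constructive_indefinite_description _ (H (delta_mx 0 i)))).
exists (\matrix_(i < m) y i); apply/row_matrixP => i.
by rewrite row_mul rowK -yE rowE.
Qed.

Lemma row_eq0_mx m n (X : 'M[T]_(m, n)) : (forall v : 'rV_m, v *m X = 0) -> X = 0.
Proof. by move=> H; apply/row_matrixP => i; rewrite rowE H row0. Qed.

End MatrixLift.

(** * Submodules of free modules over a noetherian ring *)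

Section Noetherian.
Variable T : comUnitRingType.
Hypothesis noethT : noetherian T.

(** Induction on the rank: the first coordinates of [N] form an ideal, whose generators lift to the
    rows of [L]; the vectors of [N] with first coordinate zero live in a free module of rank one
    less and are generated by [G']. *)
Lemma submodule_fg n (N : 'rV[T]_n -> Prop) :
  N 0 -> (forall u v, N u -> N v -> N (u + v)) -> (forall r u, N u -> N (r *: u)) ->
  exists m (G : 'M[T]_(m, n)), forall v, N v <-> exists w, v = w *m G.
Proof.
elim: n N => [|n IHn] N N0 ND NZ.
  exists 0%N, 0 => v; split=> _; last by rewrite [v]thinmx0.
  by exists 0; rewrite [v]thinmx0 mulmx0.
have sub_lin m (G : 'M[T]_(m, 1 + n)) :
    (forall i, N (row i G)) -> forall w : 'rV_m, N (w *m G).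
  move=> NG w; rewrite mulmx_sum_row.
  by elim/big_ind: _ => // i _; apply: NZ.
pose I x := exists2 v : 'rV[T]_(1 + n), N v & v 0 0 = x.
have [|s [sI Is]] := noethT (I := I).
  split; first by exists 0; rewrite ?mxE.
  split=> [x y [u Nu <-] [v Nv <-]|r x [u Nu <-]].
    by exists (u + v); [apply: ND | rewrite mxE].
  by exists (r *: u); [apply: NZ | rewrite mxE].
have lift (i : 'I_(size s)) : {v : 'rV[T]_(1 + n) | N v /\ v 0 0 = s`_i}.
  apply: constructive_indefinite_description.
  by have [|v Nv v0] := sI s`_i; [apply: mem_nth | exists v].
pose L : 'M[T]_(size s, 1 + n) := \matrix_i sval (lift i).
have NL i : N (row i L) by rewrite rowK; case: (svalP (lift i)).
have [|||m [G' G'P]] := IHn (fun u => N (row_mx 0 u : 'rV_(1 + n))).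
- by rewrite row_mx0.
- by move=> u v Nu Nv; rewrite -[0]addr0 -add_row_mx; apply: ND.
- by move=> r u Nu; rewrite -[0](scaler0 _ r) -scale_row_mx; apply: NZ.
pose G : 'M[T]_(size s + m, 1 + n) := col_mx L (row_mx 0 G').
have NG i : N (row i G).
  rewrite -[i]splitK; case: (split i) => j /=; rewrite ?col_mxKu ?col_mxKd.
    by rewrite rowKu.
  by rewrite rowKd row_row_mx row0; apply/G'P; exists (delta_mx 0 j); rewrite rowE.
exists (size s + m)%N, G => v; split=> [Nv|[w ->]]; last exact: sub_lin.
have [|c [sc cE]] := Is (v 0 0); first by exists v.
pose x : 'rV[T]_(size s) := \row_i c`_i.
(* The combination of lifts removes the first coordinate of [v], so the rest falls under the
   induction hypothesis. *)
pose v' : 'rV[T]_(1 + n) := v - x *m L.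
have Nv' : N v'.
  by apply: ND => //; rewrite -scaleN1r; apply: NZ; apply: sub_lin.
have v'0 : v' = row_mx 0 (rsubmx v').
  rewrite -[LHS]hsubmxK; congr row_mx; apply/rowP => j; rewrite !ord1 !mxE.
  have -> : lshift n (0 : 'I_1) = 0 by apply/val_inj.
  rewrite cE -sumrB big1 // => i _; rewrite !mxE.
  by case: (svalP (lift i)) => _ ->; rewrite subrr.
have [|y yE] := (G'P (rsubmx v')).1; first by rewrite -v'0.
have yG : y *m row_mx 0 G' = v' by rewrite mul_mx_row mulmx0 -yE -v'0.
have xyG : row_mx x y *m G = x *m L + v' by rewrite mul_row_col yG.
by exists (row_mx x y); rewrite xyG addrC subrK.
Qed.

End Noetherian.

(** * Free resolutions, chain maps and homotopies *)

(** Used in both directions, this says that two augmentations resolve the same module. *)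
Definition sub_image (A B W : Type) (e : A -> W) (e' : B -> W) : Prop :=
  forall v, exists w, e v = e' w.

Section FreeResolutions.
Variables (T S : comUnitRingType) (phi : T -> S) (V : lmodType S).

Definition semilinear n (eps : 'rV[T]_n -> V) : Prop :=
  (forall u v, eps (u + v) = eps u + eps v) /\
  (forall r v, eps (r *: v) = phi r *: eps v).

(* Dropping the surjectivity of eps, this is a resolution of the image of eps:
   syzygies can thus be treated without forming submodule types. *)
Definition resolves_image (b : nat -> nat) (d : forall n, 'M[T]_(b n.+1, b n))
    (eps : 'rV[T]_(b 0%N) -> V) : Prop :=
  [/\ semilinear eps,
      forall v, eps v = 0 <-> exists w, v = w *m d 0%N &
      forall n (v : 'rV[T]_(b n.+1)), v *m d n = 0 <-> exists w, v = w *m d n.+1].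

Section Semilinear.
Variables (n : nat) (eps : 'rV[T]_n -> V).
Hypothesis eps_lin : semilinear eps.

Lemma semilinear0 : eps 0 = 0.
Proof.
case: eps_lin => epsD _; apply: (addrI (eps 0)).
by rewrite -epsD !addr0.
Qed.

Lemma semilinearN v : eps (- v) = - eps v.
Proof.
case: eps_lin => epsD _; apply: (addrI (eps v)).
by rewrite -epsD !subrr semilinear0.
Qed.

Lemma semilinearB u v : eps (u - v) = eps u - eps v.
Proof. by case: eps_lin => epsD _; rewrite epsD semilinearN. Qed.

Lemma semilinear_mulmx m (E : 'M[T]_(m, n)) : semilinear (fun w => eps (w *m E)).
Proof.
case: eps_lin => epsD epsZ.
by split=> [u v|r v]; [rewrite mulmxDl epsD | rewrite -scalemxAl epsZ].
Qed.

End Semilinear.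

Lemma semilinear_eq m n (e : 'rV[T]_m -> V) (e' : 'rV[T]_n -> V) (X : 'M[T]_(m, n)) :
  semilinear e -> semilinear e' ->
  (forall i, e (delta_mx 0 i) = e' (row i X)) -> forall v, e v = e' (v *m X).
Proof.
move=> eL e'L eX v.
have e'XL := semilinear_mulmx e'L X.
rewrite [v]row_sum_delta; elim/big_ind: _ => [|u w Eu Ew|i _].
- by rewrite semilinear0 // (semilinear0 e'XL).
- by case: eL => -> _; case: e'XL => -> _; rewrite Eu Ew.
by case: eL => _ ->; case: e'XL => _ ->; rewrite eX rowE.
Qed.

(** Free modules are projective: it suffices to choose preimages of the basis vectors. *)
Lemma semilinear_lift m n (e : 'rV[T]_m -> V) (e' : 'rV[T]_n -> V) :
  semilinear e -> semilinear e' -> sub_image e e' ->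
  exists X : 'M_(m, n), forall v, e v = e' (v *m X).
Proof.
move=> eL e'L sub.
pose x i := proj1_sig (constructive_indefinite_description _ (sub (delta_mx 0 i))).
exists (\matrix_(i < m) x i); apply: semilinear_eq => // i; rewrite rowK.
exact: (proj2_sig (constructive_indefinite_description _ (sub (delta_mx 0 i)))).
Qed.

Section Comparison.
Variables (b c : nat -> nat).
Variables (d : forall n, 'M[T]_(b n.+1, b n)) (e : 'rV[T]_(b 0%N) -> V).
Variables (d' : forall n, 'M[T]_(c n.+1, c n)) (e' : 'rV[T]_(c 0%N) -> V).
Hypotheses (dF : resolves_image d e) (dG : resolves_image d' e').

Lemma resolution_mul0 n : d n.+1 *m d n = 0.
Proof.
case: dF => _ _ ex; apply: row_eq0_mx => v; rewrite mulmxA.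
by apply/ex; exists v.
Qed.

Lemma resolution_eps0 v : e (v *m d 0%N) = 0.
Proof. by case: dF => _ ex _; apply/ex; exists v. Qed.

Lemma resolution_lift n m (X : 'M[T]_(m, c n.+1)) :
  X *m d' n = 0 -> exists Y, X = Y *m d' n.+1.
Proof.
move=> X0; apply: rows_lift => v; case: dG => _ _ ex.
by apply/ex; rewrite -mulmxA X0 mulmx0.
Qed.

Lemma resolution_lift0 m (X : 'M[T]_(m, c 0%N)) :
  (forall v, e' (v *m X) = 0) -> exists Y, X = Y *m d' 0%N.
Proof. by move=> X0; apply: rows_lift => v; case: dG => _ ex _; apply/ex. Qed.

Lemma chain_map_lift : sub_image e e' ->
  exists f : forall n, 'M[T]_(b n, c n),
    (forall v, e v = e' (v *m f 0%N)) /\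
    (forall n, d n *m f n = f n.+1 *m d' n).
Proof.
case: (dF) (dG) => eL _ _ [e'L _ _] /(semilinear_lift eL e'L)[f0 f0E].
(* This invariant is what allows the next component to be chosen. *)
pose P n (f : 'M[T]_(b n, c n)) := exists Y, d n *m f = Y *m d' n.
pose Q n (f : 'M[T]_(b n, c n)) (f' : 'M_(b n.+1, c n.+1)) :=
  d n *m f = f' *m d' n.
have [||f [f_0 fE]] := @dependent_choice _ P Q f0.
- apply: resolution_lift0 => v.
  by rewrite mulmxA -f0E resolution_eps0.
- move=> n f [Y fY]; exists Y; split=> //; apply: resolution_lift.
  by rewrite -mulmxA -fY mulmxA resolution_mul0 mul0mx.
by exists f; split=> [v|n]; [rewrite f_0 | case: (fE n)].
Qed.

(** A chain map inducing zero on the resolved modules is null-homotopic; the homotopy is built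
    degree by degree. *)
Lemma chain_map_null_homotopic (f : forall n, 'M[T]_(b n, c n)) :
  (forall v, e' (v *m f 0%N) = 0) ->
  (forall n, d n *m f n = f n.+1 *m d' n) ->
  exists h : forall n, 'M[T]_(b n, c n.+1),
    f 0%N = h 0%N *m d' 0%N /\
    forall n, f n.+1 = d n *m h n + h n.+1 *m d' n.+1.
Proof.
move=> f0 fE.
have [h0 h0E] := resolution_lift0 f0.
(* The invariant says that [f n.+1 - d n *m h] is a cycle, hence a boundary. *)
pose P n (h : 'M[T]_(b n, c n.+1)) := d n *m f n = d n *m h *m d' n.
pose Q n (h : 'M[T]_(b n, c n.+1)) (h' : 'M_(b n.+1, c n.+2)) :=
  f n.+1 = d n *m h + h' *m d' n.+1.
have [||h [h_0 hE]] := @dependent_choice _ P Q h0.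
- by rewrite /P h0E mulmxA.
- move=> n h Ph.
  have [|h' h'E] := @resolution_lift n _ (f n.+1 - d n *m h).
    by rewrite mulmxBl -fE Ph subrr.
  have fE' : f n.+1 = d n *m h + h' *m d' n.+1 by rewrite -h'E addrC subrK.
  exists h'; split=> //.
  by rewrite /P fE' mulmxDr !mulmxA resolution_mul0 mul0mx add0r.
by exists h; split=> [|n]; [rewrite h_0 | case: (hE n)].
Qed.

End Comparison.
End FreeResolutions.

(** * Tor ranks computed by comparison with a minimal resolution *)

Section Invariance.

(** [D] enters the middle space and [D'] leaves it. The kernel of [D'] is the direct sum of the
    image of [D] and that of [g], which has rank [c], so the homology has dimension [c]. *)
Lemma rank_minimal_part (k : fieldType) (p m l c : nat)
    (D : 'M[k]_(p, m)) (D' : 'M[k]_(m, l)) (f : 'M[k]_(m, c)) (g : 'M[k]_(c, m))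
    (h : 'M[k]_(m, p)) (h' : 'M[k]_(l, m)) :
  D *m D' = 0 -> g *m f = 1%:M -> f *m g = 1%:M + D' *m h' + h *m D ->
  D *m f = 0 -> g *m D' = 0 ->
  (m - \rank D - \rank D' = c)%N.
Proof.
move=> DD' gf fg Df gD'.
have rg : \rank g = c by apply/eqP; apply/row_freeP; exists f.
have cap0 : (D :&: g)%MS = 0.
  apply/eqP; rewrite -submx0; apply/rV_subP => v.
  rewrite sub_capmx => /andP[/submxP[u ->] /submxP[w uE]].
  (* A common vector [u *m D = w *m g] is killed by [f], whereas [g *m f] is the identity. *)
  have w0 : w = 0 by rewrite -[w]mulmx1 -gf mulmxA -uE -mulmxA Df mulmx0.
  by rewrite uE w0 mul0mx sub0mx.
have kerE : (kermx D' :=: D + g)%MS.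
  apply/eqmxP/andP; split; last first.
    by rewrite addsmx_sub !sub_kermx DD' gD' !eqxx.
  apply/rV_subP => v; rewrite sub_kermx => /eqP vD'.
  (* The homotopy formula for [f *m g], applied to [v] in the kernel of [D']. *)
  have -> : v = (- (v *m h)) *m D + (v *m f) *m g.
    rewrite -[v *m f *m g]mulmxA fg !mulmxDr mulmx1 !mulmxA vD' mul0mx addr0.
    by rewrite mulNmx addrC addrK.
  by rewrite addmx_sub_adds ?submxMl.
have := mxrank_sum_cap D g; rewrite cap0 mxrank0 addn0 -kerE mxrank_ker rg => mE.
by rewrite subnAC mE addKn.
Qed.

Variables (T S : comUnitRingType) (phi : T -> S) (V : lmodType S).
Variables (k : fieldType) (pi : {rmorphism T -> k}).

Lemma tor_dim_minimal (b : nat -> nat) (d : forall n, 'M[T]_(b n.+1, b n)) n :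
  (forall n, map_mx pi (d n) = 0) -> tor_dim pi b d n = b n.
Proof. by move=> d0; case: n => [|n]; rewrite /tor_dim !d0 !mxrank0 !subn0. Qed.

Variables (b c : nat -> nat).
Variables (d : forall n, 'M[T]_(b n.+1, b n)) (e : 'rV[T]_(b 0%N) -> V).
Variables (d' : forall n, 'M[T]_(c n.+1, c n)) (e' : 'rV[T]_(c 0%N) -> V).

Lemma endo_homotopic_id (f : forall n, 'M[T]_(b n, b n)) :
  resolves_image phi d e ->
  (forall v, e (v *m f 0%N) = e v) ->
  (forall n, d n *m f n = f n.+1 *m d n) ->
  exists h : forall n, 'M[T]_(b n, b n.+1),
    f 0%N = 1%:M + h 0%N *m d 0%N /\
    forall n, f n.+1 = 1%:M + d n *m h n + h n.+1 *m d n.+1.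
Proof.
move=> dF f0 fE.
have [||h [h0 hS]] := @chain_map_null_homotopic _ _ _ _ _ _ _ _ _ _ dF dF
  (fun n => f n - 1%:M).
- move=> v; have [eL _ _] := dF.
  by rewrite mulmxBr mulmx1 (semilinearB eL) f0 subrr.
- by move=> n; rewrite mulmxBr mulmxBl fE mulmx1 mul1mx.
exists h; split=> [|n]; first by rewrite -h0 addrC subrK.
by rewrite -addrA -hS addrC subrK.
Qed.

(** Lifts [f] and [g] of the identity exist both ways. Their composite on the minimal side is
    homotopic to the identity, and over [k] equal to it, because every homotopy term contains a
    differential [d']. *)
Lemma tor_dim_eq_minimal_rank :
  resolves_image phi d e -> resolves_image phi d' e' ->
  sub_image e e' -> sub_image e' e -> (forall n, map_mx pi (d' n) = 0) ->
  forall n, tor_dim pi b d n = c n.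
Proof.
move=> dF dG see' se'e min.
have [f [f0 fS]] := chain_map_lift dF dG see'.
have [g [g0 gS]] := chain_map_lift dG dF se'e.
have [||h [h0 hS]] := @endo_homotopic_id (fun n => f n *m g n) dF.
- by move=> v; rewrite mulmxA -g0 -f0.
- by move=> n; rewrite mulmxA fS -mulmxA gS mulmxA.
have gf n : map_mx pi (g n *m f n) = 1%:M.
  have [||h' [h'0 h'S]] := @chain_map_null_homotopic _ _ _ _ _ _ _ _ _ _ dG dG
    (fun n => g n *m f n - 1%:M).
  + move=> v; have [eL _ _] := dG.
    by rewrite mulmxBr mulmx1 (semilinearB eL) mulmxA -f0 -g0 subrr.
  + by move=> m; rewrite mulmxBr mulmxBl mulmxA gS -mulmxA fS mulmxA mulmx1 mul1mx.
  have {h'0 h'S} : map_mx pi (g n *m f n - 1%:M) = 0.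
    case: n => [|n]; first by rewrite h'0 map_mxM min mulmx0.
    by rewrite h'S map_mxD !map_mxM !min mulmx0 mul0mx addr0.
  by rewrite map_mxB map_mx1 => /eqP; rewrite subr_eq0 => /eqP.
have df n : map_mx pi (d n) *m map_mx pi (f n) = 0.
  by rewrite -map_mxM fS map_mxM min mulmx0.
have gd n : map_mx pi (g n.+1) *m map_mx pi (d n) = 0.
  by rewrite -map_mxM -gS map_mxM min mul0mx.
move=> n; have := gf n; rewrite map_mxM => gfn.
case: n gfn => [|n] gfn.
  (* In degree 0 the map to the zero space plays the outgoing differential. *)
  have <- : (b 0%N - \rank (map_mx pi (d 0%N)) - \rank (0%R : 'M[k]_(b 0%N, 0)))%N =
            tor_dim pi b d 0%N by rewrite mxrank0.
  apply: (rank_minimal_part (h := map_mx pi (h 0%N)) (h' := 0) _ gfn);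
    rewrite ?mulmx0 ?df //.
  by rewrite -map_mxM h0 map_mxD map_mx1 map_mxM addr0.
apply: (rank_minimal_part (h := map_mx pi (h n.+1)) (h' := map_mx pi (h n)) _ gfn).
- by rewrite -map_mxM (resolution_mul0 dF) map_mx0.
- by rewrite -map_mxM hS !map_mxD map_mx1 !map_mxM.
- exact: df.
exact: gd.
Qed.

End Invariance.

(** * Minimal free resolutions over a noetherian local ring *)

Section MinimalResolutions.
Variables (T : comUnitRingType) (k : fieldType) (pi : {rmorphism T -> k}).
Hypotheses (noethT : noetherian T) (piP : residue_map pi).

Lemma unit_residue x : pi x != 0 -> x \is a GRing.unit.
Proof. by case: piP => _ pi0; apply: contraR => /pi0 ->. Qed.

(** A relation with a unit coordinate [w 0 j] makes the [j]-th generator redundant; discarding such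
    generators ends by induction on [m]. *)
Lemma minimal_generators (S : comUnitRingType) (phi : T -> S) (V : lmodType S)
    m (e : 'rV[T]_m -> V) : semilinear phi e ->
  exists m' (E : 'M[T]_(m', m)), sub_image e (fun w => e (w *m E)) /\
    forall w, e (w *m E) = 0 -> map_mx pi w = 0.
Proof.
elim: m e => [|m IHm] e eL.
  exists 0%N, 1%:M; split=> [v|w _]; last exact: thinmx0.
  by exists v; rewrite mulmx1.
have [min|] := classic (forall w, e w = 0 -> map_mx pi w = 0).
  by exists m.+1, 1%:M; split=> [v|w]; rewrite ?mulmx1; [exists v; rewrite mulmx1 | exact: min].
move=> /not_all_ex_not nmin; have [w nw] := nmin.
have [ew0 nw0] := imply_to_and _ _ nw.
have [j /unit_residue wj] : exists j, pi (w 0 j) != 0.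
  apply: NNPP => nwj; apply: nw0; apply/rowP => j; rewrite !mxE.
  by apply/eqP/negPn/negP => wj; apply: nwj; exists j.
pose D : 'M[T]_(m, m.+1) := row' j 1%:M.
have [m' [E [subE minE]]] := IHm _ (semilinear_mulmx eL D).
exists m', (E *m D); split=> [v|u]; last by rewrite mulmxA; exact: minE.
(* A multiple of the relation [w] clears the [j]-th coordinate without changing the value of [e]. *)
pose v' := v - (v 0 j / w 0 j) *: w.
have ev' : e v = e v'.
  by rewrite (semilinearB eL); case: (eL) => _ ->; rewrite ew0 scaler0 subr0.
have v'D : v' = col' j v' *m D.
  apply/rowP => i; rewrite [in RHS]mxE; under eq_bigr do rewrite mxE [row' _ _ _ _]mxE [1%:M _ _]mxE.
  case: (unliftP j i) => [l ->|->].
    rewrite (bigD1 l) //= eqxx mulr1 big1 ?addr0 ?mxE // => l' l'l.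
    by rewrite (inj_eq lift_inj) (negPf l'l) mulr0.
  rewrite [LHS]mxE ![in LHS]mxE mulrVK // subrr big1 // => l _.
  by rewrite eq_sym (negPf (neq_lift _ _)) mulr0.
have [u uE] := subE (col' j v').
by exists u; rewrite ev' v'D uE mulmxA.
Qed.

Lemma minimal_cover (S : comUnitRingType) (phi : T -> S) (V : lmodType S)
    m (e : 'rV[T]_m -> V) : semilinear phi e ->
  exists m' (E : 'M[T]_(m', m)), (forall v, e v = 0 <-> exists w : 'rV_m', v = w *m E) /\
    forall w : 'rV_m', w *m E = 0 -> map_mx pi w = 0.
Proof.
move=> eL; have [p [G GP]] : exists p (G : 'M[T]_(p, m)),
    forall v, e v = 0 <-> exists w : 'rV_p, v = w *m G.
  apply: submodule_fg => //; first exact: semilinear0 eL.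
    by move=> u v eu ev; case: eL => -> _; rewrite eu ev addr0.
  by move=> r u eu; case: eL => _ ->; rewrite eu scaler0.
have GL : semilinear id (fun w : 'rV_p => w *m G).
  by split=> [u v|r v]; [rewrite mulmxDl | rewrite scalemxAl].
have [m' [E [subE minE]]] := minimal_generators GL.
exists m', (E *m G); split=> [v|w]; last by rewrite mulmxA; exact: minE.
rewrite GP; split=> [[w ->]|[w ->]]; last by exists (w *m E); rewrite mulmxA.
by have [u ->] := subE w; exists u; rewrite mulmxA.
Qed.

(** Bundling the sizes gives the recursion that builds a resolution a single type to run on. *)
Record differential := Differential
  { dsource : nat; dtarget : nat; dmx : 'M[T]_(dsource, dtarget) }.

(** Each differential lists minimal generators of the preceding kernel. Its image consists of
    relations among minimal generators, so its entries lie in the maximal ideal. *)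
Lemma minimal_resolution_exists (S : comUnitRingType) (phi : T -> S)
    (V : lmodType S) m (e0 : 'rV[T]_m -> V) : semilinear phi e0 ->
  exists b (d : forall n, 'M[T]_(b n.+1, b n)) (e : 'rV[T]_(b 0%N) -> V),
    [/\ resolves_image phi d e, sub_image e0 e, sub_image e e0 &
        forall n, map_mx pi (d n) = 0].
Proof.
move=> e0L; have [b0 [E0 [subE minE]]] := minimal_generators e0L.
pose e w := e0 (w *m E0).
have eL : semilinear phi e by exact: semilinear_mulmx.
have [b1 [d0 [d0P d0min]]] := minimal_cover eL.
have next (D : differential) : {D' : {b & 'M[T]_(b, dsource D)} |
    (forall v : 'rV_(dsource D), v *m dmx D = 0 <-> exists w, v = w *m projT2 D') /\
    forall w : 'rV_(projT1 D'), w *m projT2 D' = 0 -> map_mx pi w = 0}.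
  apply: constructive_indefinite_description.
  have DL : semilinear id (fun w : 'rV_(dsource D) => w *m dmx D).
    by split=> [u v|r v]; [rewrite mulmxDl | rewrite scalemxAl].
  by have [b [D' D'P]] := minimal_cover DL; exists (existT _ b D').
pose fix D n := if n is n'.+1
  then Differential (projT2 (sval (next (D n')))) else Differential d0.
pose b n := dtarget (D n).
(* Well typed since [dtarget (D n.+1)] computes to [dsource (D n)]. *)
pose d n : 'M[T]_(b n.+1, b n) := dmx (D n).
have ker_min n (w : 'rV_(b n.+1)) : w *m d n = 0 -> map_mx pi w = 0.
  by case: n w => [|n] w; [exact: d0min | case: (svalP (next (D n))) => _; apply].
exists b, d, e; split.
- by split=> // n v; case: (svalP (next (D n))).
- exact: subE.
- by move=> v; exists (v *m E0).
have d_min n : (forall v : 'rV_(b n.+1), map_mx pi (v *m d n) = 0) -> map_mx pi (d n) = 0.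
  by move=> dn0; apply/row_matrixP => i; rewrite -map_row rowE dn0 row0.
case=> [|n]; apply: d_min => v.
  by apply: minE; apply/d0P; exists v.
apply: (ker_min n); have [+ _] := svalP (next (D n)).
by move=> /(_ (v *m d n.+1))[_ ->] //; exists v.
Qed.

End MinimalResolutions.

(** * The quotient by [a] and its two-periodic resolution *)

Section ExactPair.
Variables (R S : comUnitRingType) (k : fieldType).
Variables (piR : {rmorphism R -> k}) (q : {rmorphism R -> S}) (piS : {rmorphism S -> k}).
Variables a b : R.
Hypotheses (noethR : noetherian R) (piRP : residue_map piR).
Hypotheses (amsq : ~ in_msq piR a) (bmsq : ~ in_msq piR b).
Hypotheses (pia0 : piR a = 0) (pib0 : piR b = 0).
Hypotheses (abP : exact_pair a b) (qP : is_quotient_by q a).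
Hypothesis piSq : forall x, piS (q x) = piR x.

Lemma quotient_noetherian : noetherian S.
Proof.
case: qP => q_surj _ I [I0 [ID IZ]].
have [|s [sI Is]] := noethR (I := fun x => I (q x)).
  split; first by rewrite rmorph0.
  by split=> [x y Ix Iy|r x Ix]; [rewrite rmorphD; exact: ID | rewrite rmorphM; exact: IZ].
exists (map q s); split=> [_ /mapP[x xs ->]|y Iy]; first exact: sI.
have [x xy] := q_surj y; rewrite -xy in Iy *.
have [c [sc ->]] := Is x Iy; exists (map q c); rewrite !size_map; split=> //.
rewrite rmorph_sum; apply: eq_bigr => i _.
by rewrite rmorphM !(nth_map 0) // sc.
Qed.

Lemma quotient_residue : residue_map piS.
Proof.
case: piRP qP => piR_surj piR0 [q_surj _].
split=> [y|y]; first by have [x <-] := piR_surj y; exists (q x).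
split=> [y0|]; first by apply/negP => /(rmorph_unit piS); rewrite y0 unitr0.
have [x <-] := q_surj y => qx; rewrite piSq; apply/piR0.
by apply: contra qx; exact: rmorph_unit.
Qed.

(** If [x] were a unit, dividing by it would put [c] in the square of the maximal ideal. *)
Lemma residue_mul_notin_msq (c x : R) m (u v : 'I_m -> R) :
  ~ in_msq piR c -> (forall i, piR (u i) = 0) -> (forall i, piR (v i) = 0) ->
  c * x = \sum_i u i * v i -> piR x = 0.
Proof.
move=> cmsq u0 v0 cx; apply/eqP/negPn/negP => /(unit_residue piRP) x_unit.
apply: cmsq; exists [seq x^-1 * u i | i <- enum 'I_m], [seq v i | i <- enum 'I_m].
rewrite 2!size_map; split=> //; split=> [_ /mapP[i _ ->]|].
  by rewrite rmorphM u0 mulr0.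
split=> [_ /mapP[i _ ->] //|].
have -> : c = x^-1 * (c * x) by rewrite mulrC mulrK.
rewrite cx mulr_sumr size_enum_ord; apply: eq_bigr => i _.
by rewrite (nth_map i) ?size_enum_ord // (nth_map i 0 v) ?size_enum_ord //
  nth_ord_enum mulrA.
Qed.

(** The [n]-th differential of the periodic resolution, starting with [a] so that the cokernel is
    the quotient ring. *)
Definition pair_elt n := if odd n then b else a.

Lemma pair_elt_residue n : piR (pair_elt n) = 0.
Proof. by rewrite /pair_elt; case: ifP. Qed.

Lemma pair_elt_notin_msq n : ~ in_msq piR (pair_elt n).
Proof. by rewrite /pair_elt; case: ifP. Qed.

Lemma pair_elt_annihilator n x :
  pair_elt n * x = 0 <-> exists r, x = pair_elt n.+1 * r.
Proof.
case: abP => _ [_ [_ [_ [aP bP]]]].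
by rewrite /pair_elt /= mulrC; case: (odd n).
Qed.

Lemma pair_elt_mx_exact n m l (X : 'M[R]_(m, l)) :
  pair_elt n *: X = 0 <-> exists Y, X = pair_elt n.+1 *: Y.
Proof.
split=> [/matrixP X0|[Y ->]]; last first.
  rewrite scalerA (_ : _ * _ = 0) ?scale0r //.
  by apply/pair_elt_annihilator; exists 1; rewrite mulr1.
have ex i j : {r | X i j = pair_elt n.+1 * r}.
  apply: constructive_indefinite_description; apply/pair_elt_annihilator.
  by have := X0 i j; rewrite !mxE.
by exists (\matrix_(i, j) sval (ex i j)); apply/matrixP => i j; rewrite !mxE; case: (ex i j).
Qed.

Lemma map_mx_quotient_eq0 m l (X : 'M[R]_(m, l)) :
  map_mx q X = 0 <-> exists Y, X = a *: Y.
Proof.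
case: qP => _ q0; split=> [/matrixP X0|[Y ->]].
  have ex i j : {r | X i j = a * r}.
    apply: constructive_indefinite_description; apply/q0.
    by have := X0 i j; rewrite !mxE.
  by exists (\matrix_(i, j) sval (ex i j)); apply/matrixP => i j; rewrite !mxE; case: (ex i j).
by rewrite map_mxZ (_ : q a = 0) ?scale0r //; apply/q0; exists 1; rewrite mulr1.
Qed.

Lemma map_mx_quotient_surj m l (Y : 'M[S]_(m, l)) : exists X, map_mx q X = Y.
Proof.
case: qP => q_surj _.
have ex i j : {x | q x = Y i j} by apply: constructive_indefinite_description.
by exists (\matrix_(i, j) sval (ex i j)); apply/matrixP => i j; rewrite !mxE; case: (ex i j).
Qed.

Lemma map_mx_quotient_semilinear m :
  semilinear q (map_mx q : 'rV[R]_m -> 'rV[S]_m).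
Proof. by split=> [u v|r v]; rewrite ?map_mxD ?map_mxZ. Qed.

(** Exactness is, entry by entry, the pair of annihilator equalities. *)
Lemma pair_resolution m :
  resolves_image q (b := fun=> m) (fun n => (pair_elt n)%:M)
    (map_mx q : 'rV[R]_m -> 'rV[S]_m).
Proof.
split=> [|v|n v]; first exact: map_mx_quotient_semilinear.
  rewrite map_mx_quotient_eq0.
  by split=> -[w ->]; exists w; rewrite mul_mx_scalar.
rewrite mul_mx_scalar pair_elt_mx_exact.
by split=> -[w ->]; exists w; rewrite mul_mx_scalar.
Qed.

(** * The mapping cone over the first syzygy *)

Section Cone.
Variables (V : lmodType S) (b0 b1 : nat) (D : 'M[S]_(b1, b0)) (e : 'rV[S]_b0 -> V).
Hypothesis eL : semilinear id e.
Hypothesis eD : forall v, e v = 0 <-> exists w, v = w *m D.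
Hypothesis D_min : map_mx piS D = 0.
Variables (c : nat -> nat) (d : forall n, 'M[R]_(c n.+1, c n)).
Variable p : 'rV[R]_(c 0%N) -> 'rV[S]_b0.
Hypothesis dP : resolves_image q d p.
Hypothesis d_min : forall n, map_mx piR (d n) = 0.
Hypothesis pD : forall u, exists w, p u = w *m D.
Hypothesis Dp : forall w, exists u, w *m D = p u.

(** The image of [D] is the first syzygy of the image of [e], and [d], [p] resolve it over [R]; [f]
    lifts its inclusion in the free module over [S]. *)
Lemma chain_map_to_pair_resolution :
  exists f : forall n, 'M[R]_(c n, b0),
    [/\ forall u, p u = map_mx q (u *m f 0%N),
        forall n, d n *m f n = pair_elt n *: f n.+1 &
        forall n, map_mx piR (f n) = 0].
Proof.
have [|f [f0 fS]] := chain_map_lift dP (pair_resolution b0).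
  by move=> u; have [x <-] := map_mx_quotient_surj (p u); exists x.
have fS' n : d n *m f n = pair_elt n *: f n.+1 by rewrite fS mul_mx_scalar.
exists f; split=> //; elim=> [|n /matrixP IHn].
  (* In degree 0 the rows of [f 0] reduce to vectors in the image of [D], which vanishes over
     [k]. *)
  apply/row_matrixP => i; rewrite row0 rowE.
  have -> : delta_mx 0 i *m map_mx piR (f 0%N) = map_mx piS (p (delta_mx 0 i)).
    by rewrite f0 -!rowE; apply/rowP => j; rewrite !mxE piSq.
  by have [w ->] := pD (delta_mx 0 i); rewrite map_mxM D_min mulmx0.
(* An entry of [d n *m f n] is a sum of products of elements of the maximal ideal, and equals
   [pair_elt n] times an entry of [f n.+1]. *)
apply/matrixP => i j; rewrite !mxE.
apply: (@residue_mul_notin_msq (pair_elt n) _ _ (d n i) (fun l => f n l j)).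
- exact: pair_elt_notin_msq.
- by move=> l; have /matrixP/(_ i l) := d_min n; rewrite !mxE.
- by move=> l; have := IHn l j; rewrite !mxE.
by have /matrixP/(_ i j) := fS' n; rewrite !mxE => ->.
Qed.

(** The resolution of the syzygy is shifted up by one degree; the periodic one is not. *)
Definition cone_rank n := if n is n'.+1 then (b0 + c n')%N else b0.

(* Negating the multiplications by a and b spares f and d alternating signs. *)
Definition cone_mx (f : forall n, 'M[R]_(c n, b0)) n :
    'M[R]_(cone_rank n.+1, cone_rank n) :=
  match n return 'M[R]_(cone_rank n.+1, cone_rank n) with
  | 0%N => col_mx (- a)%:M (f 0%N)
  | n'.+1 => block_mx (- pair_elt n'.+1)%:M 0 (f n'.+1) (d n')
  end.

Lemma cone_resolution (f : forall n, 'M[R]_(c n, b0)) :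
  (forall u, p u = map_mx q (u *m f 0%N)) ->
  (forall n, d n *m f n = pair_elt n *: f n.+1) ->
  resolves_image q (b := cone_rank) (cone_mx f) (fun v => e (map_mx q v)).
Proof.
move=> f0 fS; have [_ dP0 dPS] := dP; have [eD' eZ] := eL.
split.
- by split=> [u v|r v]; rewrite ?map_mxD ?map_mxZ ?eD' ?eZ.
- move=> v; rewrite eD; split=> [[w vE]|[w ->]].
    have [u uE] := Dp w.
    (* Modulo [a], the vector [v] comes from [u]; the block [- a] supplies the remainder. *)
    have /map_mx_quotient_eq0[y yE] : map_mx q (v - u *m f 0%N) = 0.
      by rewrite map_mxB vE uE f0 subrr.
    exists (row_mx (- y) u); rewrite mul_row_col mul_mx_scalar scaleNr scalerN opprK.
    by rewrite -yE subrK.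
  rewrite -[w](@hsubmxK _ 1 b0 (c 0%N)) mul_row_col map_mxD -f0.
  have [w' ->] := pD (rsubmx w); exists w'.
  rewrite mul_mx_scalar (_ : map_mx q _ = 0) ?add0r //.
  by apply/map_mx_quotient_eq0; exists (- lsubmx w); rewrite scalerN scaleNr.
(* With [u = w *m d n], the difference [x - w *m f n.+1] is killed by [pair_elt n], hence is a
   multiple of [pair_elt n.+1]. *)
have exact_step n (x : 'rV[R]_b0) (u : 'rV[R]_(c n)) :
    (exists w, u = w *m d n) -> u *m f n = pair_elt n *: x ->
    exists w : 'rV[R]_(b0 + c n.+1), row_mx x u = w *m cone_mx f n.+1.
  move=> [w uE]; rewrite uE -mulmxA fS -scalemxAr => xE.
  have /pair_elt_mx_exact[y yE] : pair_elt n *: (x - w *m f n.+1) = 0.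
    by rewrite scalerBr xE subrr.
  exists (row_mx (- y) w); rewrite mul_row_block mulmx0 add0r.
  by rewrite mul_mx_scalar scaleNr scalerN opprK -yE subrK.
have pair0 n m l (X : 'M[R]_(m, l)) : pair_elt n *: (pair_elt n.+1 *: X) = 0.
  by apply/pair_elt_mx_exact; exists X.
case=> [|n] v; split.
- rewrite -[v](@hsubmxK _ 1 b0 (c 0%N)) mul_row_col mul_mx_scalar scaleNr addrC.
  move=> /eqP; rewrite subr_eq0 => /eqP vE; apply: (exact_step 0%N) => //.
  (* The cycle condition makes the image under [f 0] a multiple of [a], so [p] kills the second
     component. *)
  by apply/dP0; rewrite f0 vE; apply/map_mx_quotient_eq0; eexists.
- case=> w ->; rewrite -[w](@hsubmxK _ 1 b0 (c 1%N)) /= mul_row_block mul_row_col.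
  rewrite mulmx0 add0r !mul_mx_scalar scalerDr -mulmxA fS -scalemxAr.
  by rewrite !scaleNr scalerN opprK (pair0 0%N) add0r addNr.
- rewrite -[v](@hsubmxK _ 1 b0 (c n.+1)) mul_row_block mulmx0 add0r.
  rewrite -[0 in X in X -> _](@row_mx0 _ 1 b0 (c n)) => /eq_row_mx[+ /dPS].
  rewrite mul_mx_scalar scaleNr addrC => /eqP; rewrite subr_eq0 => /eqP vE du.
  exact: (exact_step n.+1).
case=> w ->; rewrite -[w](@hsubmxK _ 1 b0 (c n.+2)) /= !mul_row_block.
rewrite !mulmx0 !add0r !mul_mx_scalar scalerDr -!mulmxA fS -scalemxAr.
rewrite (resolution_mul0 dP) mulmx0 !scaleNr scalerN opprK (pair0 n.+1) add0r addNr.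
exact: row_mx0.
Qed.

Lemma cone_mx_minimal (f : forall n, 'M[R]_(c n, b0)) :
  (forall n, map_mx piR (f n) = 0) -> forall n, map_mx piR (cone_mx f n) = 0.
Proof.
move=> f_min [|n] /=.
  by rewrite map_col_mx f_min map_scalar_mx rmorphN /= pia0 oppr0 raddf0 col_mx0.
by rewrite map_block_mx f_min d_min map_scalar_mx rmorphN /= pair_elt_residue oppr0
  raddf0 map_mx0 block_mx0.
Qed.

End Cone.

(** * Recursion on syzygies and the conclusion *)

Lemma tor_dim_cone (V : lmodType S)
    (bR : nat -> nat) (dR : forall n, 'M[R]_(bR n.+1, bR n)) (eR : 'rV[R]_(bR 0%N) -> V)
    (bS : nat -> nat) (dS : forall n, 'M[S]_(bS n.+1, bS n)) (eS : 'rV[S]_(bS 0%N) -> V) :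
  resolves_image q dR eR -> resolves_image id dS eS ->
  sub_image eR eS -> sub_image eS eR -> map_mx piS (dS 0%N) = 0 ->
  exists c (d : forall n, 'M[R]_(c n.+1, c n)) (p : 'rV[R]_(c 0%N) -> 'rV[S]_(bS 0%N)),
    [/\ resolves_image q d p, sub_image p (mulmxr (dS 0%N)), sub_image (mulmxr (dS 0%N)) p,
        forall n, map_mx piR (d n) = 0 &
        forall n, tor_dim piR bR dR n = cone_rank (bS 0%N) c n].
Proof.
move=> FR FS RS SR dS_min; have [eSL eSker _] := FS.
(* As [q] is surjective, this map presents the first syzygy as an image of a free module over
   [R]. *)
have qdSL : semilinear q (fun w : 'rV[R]_(bS 1%N) => map_mx q w *m dS 0%N).
  by split=> [u v|r v]; [rewrite map_mxD mulmxDl | rewrite map_mxZ scalemxAl].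
have [c [d [p [dP Dp pD d_min]]]] := minimal_resolution_exists noethR piRP qdSL.
have pD' : sub_image p (mulmxr (dS 0%N)).
  by move=> u; have [w ->] := pD u; eexists.
have Dp' : sub_image (mulmxr (dS 0%N)) p.
  by move=> w; have [x <-] := map_mx_quotient_surj w; exact: Dp.
have [f [f0 fS f_min]] := chain_map_to_pair_resolution dS_min dP d_min pD'.
have coneP := cone_resolution eSL eSker dP pD' Dp' f0 fS.
exists c, d, p; split=> //.
apply: (tor_dim_eq_minimal_rank FR coneP _ _ (cone_mx_minimal d_min f_min)) => v.
  by have [w ->] := RS v; have [x <-] := map_mx_quotient_surj w; exists x.
by have [w ->] := SR (map_mx q v); exists w.
Qed.

(** Induction on the degree for all modules and resolutions at once, since the step passes to the
    first syzygy. *)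
Lemma tor_dim_exact_pair n (V : lmodType S)
    (bR : nat -> nat) (dR : forall n, 'M[R]_(bR n.+1, bR n)) (eR : 'rV[R]_(bR 0%N) -> V)
    (bS : nat -> nat) (dS : forall n, 'M[S]_(bS n.+1, bS n)) (eS : 'rV[S]_(bS 0%N) -> V) :
  resolves_image q dR eR -> resolves_image id dS eS ->
  sub_image eR eS -> sub_image eS eR -> (forall n, map_mx piS (dS n) = 0) ->
  tor_dim piR bR dR n = (\sum_(i < n.+1) bS i)%N.
Proof.
elim: n V bR dR eR bS dS eS => [|n IHn] V bR dR eR bS dS eS FR FS RS SR dS_min;
  have [c [d [p [dP pD Dp d_min ->]]]] := tor_dim_cone FR FS RS SR (dS_min 0%N).
  by rewrite big_ord1.
(* Dropping the first term of [dS] leaves a resolution of the image of [dS 0]. *)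
have shiftP : resolves_image id (fun n => dS n.+1) (mulmxr (dS 0%N) : 'rV_(bS 1%N) -> _).
  have [_ _ eSex] := FS; split=> [|v|m v]; [|exact: eSex|exact: eSex].
  by split=> [u v|r v] /=; [rewrite mulmxDl | rewrite scalemxAl].
(* The term [bS 0] splits off; the rest counts the syzygy, for which [c n] is the Tor rank as [d] is
   minimal. *)
rewrite big_ord_recl -(IHn _ _ _ _ _ _ _ dP shiftP pD Dp (fun m => dS_min m.+1)).
by rewrite tor_dim_minimal.
Qed.

End ExactPair.

(** Multiplying a power series by [1/(1-t)] replaces its coefficients by their partial sums, so the
    identity is stated coefficientwise. *)
Theorem theorem1p8
  (R : comUnitRingType) (k : fieldType) (piR : {rmorphism R -> k})
  (S : comUnitRingType) (q : {rmorphism R -> S}) (piS : {rmorphism S -> k})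
  (a b : R) (M : lmodType S) :
  noetherian R -> residue_map piR ->
  piR a = 0 -> ~ in_msq piR a -> piR b = 0 -> ~ in_msq piR b ->
  exact_pair a b ->
  is_quotient_by q a -> (forall x, piS (q x) = piR x) ->
  module_fg M ->
  forall (bR : nat -> nat) (dR : forall n, 'M[R]_(bR n.+1, bR n))
         (epsR : 'rV[R]_(bR 0%N) -> M),
  is_free_resolution q bR dR epsR ->
  forall (bS : nat -> nat) (dS : forall n, 'M[S]_(bS n.+1, bS n))
         (epsS : 'rV[S]_(bS 0%N) -> M),
  is_free_resolution id bS dS epsS ->
  forall n : nat,
  tor_dim piR bR dR n = (\sum_(i < n.+1) tor_dim piS bS dS i)%N.
Proof.
move=> noethR piRP pia0 amsq pib0 bmsq abP qP piSq _.
move=> bR dR eR [eRD [eRZ [eR_surj [eRker eRex]]]].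
move=> bS dS eS [eSD [eSZ [eS_surj [eSker eSex]]]] n.
have FR : resolves_image q dR eR by [].
have FS : resolves_image id dS eS by [].
(* The given resolution over [S] may not be minimal; a minimal one has the same Tor ranks. *)
have [c [d [e [dP Se eS' min]]]] := minimal_resolution_exists
  (quotient_noetherian noethR qP) (quotient_residue piRP qP piSq)
  (conj eSD eSZ : semilinear id eS).
under eq_bigr do rewrite (tor_dim_eq_minimal_rank FS dP Se eS' min).
apply: (tor_dim_exact_pair noethR piRP amsq bmsq pia0 pib0 abP qP piSq n FR dP _ _ min) => v.
  by have [w <-] := eS_surj (eR v); exact: Se.
by have [w <-] := eR_surj (e v); exists w.
Qed.
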